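(* Let $\alpha,\kappa_{CP},\zeta,\hat N>0$ with $\kappa_{CP}\zeta>e$. Fix an epoch $t$, a demand $d_t\ge 0$ and a price $p_t\in\mathbb R$ quoted by the SP. Then the equilibrium (optimal) decision $(b_t^*,z_t^* )$ of the short-sighted CP is as follows. (i) If $0<d_t\le \hat N/\zeta$, then $$(b_t^*,z_t^* )=\begin{cases}(\hat N,1) & \text{if } p_t\le \frac{\alpha d_t}{\hat N},\\[2pt] \left(\frac{\alpha d_t}{p_t},1\right) & \text{if } \frac{\alpha d_t}{\hat N}\le p_t\le \frac{\alpha}{\zeta},\\[2pt] (\zeta d_t,1) & \text{if } \frac{\alpha}{\zeta}\le p_t\le \frac{\alpha\log(\kappa_{CP}\zeta)}{\zeta},\\[2pt] (-,0) & \text{if } p_t>\frac{\alpha\log(\kappa_{CP}\zeta)}{\zeta}.\end{cases}$$ (ii) If $d_t>\hat N/\zeta$ or $d_t=0$, then $(b_t^*,z_t^* )=(-,0)$. Here ''$-$'' means that no number of sponsored bits is chosen.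
   Context: A content provider (CP) may sponsor $b_t$ resources (bits) of a service provider (SP) at epoch $t$ at price $p_t$ per bit. The demand for the CP's content is $d_t$. The CP's utility if she joins is $$u_{CP,t}(b_t)=u_{ad}(b_t)-p_tb_t,\qquad u_{ad}(b_t)=\begin{cases}\alpha d_t\log\left(\frac{\kappa_{CP}b_t}{d_t}\right)& d_t>0,\\ 0& d_t=0.\end{cases}$$ Given $d_t$ and $p_t$, the short-sighted CP solves $$\max_{b_t>0}\ u_{CP,t}(b_t)\quad\text{subject to}\quad \frac{b_t}{d_t}\ge\zeta,\quad b_t\le\hat N,$$ where $\zeta$ is the minimum average quality and $\hat N$ the maximum number of bits that can be sponsored. Let $u_{CP,t}^*$ be the optimal value. The participation variable $z_t^*\in\{0,1\}$ ($1$ = join, $0$ = exit) is set to $0$ if $d_t=0$, or the problem is infeasible, or $u_{CP,t}^*<0$; otherwise $z_t^*=1$ (in particular an indifferent CP joins), and then $b_t^*$ is the maximizer. *)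

(* Defs.v *)
From HB Require Import structures.
From mathcomp Require Import all_boot all_order all_algebra.
From mathcomp Require Import all_classical all_reals all_analysis.

Set Implicit Arguments.
Unset Strict Implicit.
Unset Printing Implicit Defensive.

Import Order.TTheory GRing.Theory Num.Theory.
Local Open Scope classical_set_scope.
Local Open Scope ring_scope.

(* A single epoch is considered: d is the demand and p the
   price per bit at that epoch. *)

Definition u_ad (R : realType) (alpha kappa d b : R) : R :=
  if 0 < d then alpha * d * ln (kappa * b / d) else 0.

Definition u_CP (R : realType) (alpha kappa d p b : R) : R :=
  u_ad alpha kappa d b - p * b.

(* In MathComp b / 0 = 0, so this set is empty for d = 0 and 0 < zeta; the case
   d = 0 is nevertheless treated separately in [participation]. *)
Definition feasible (R : realType) (zeta Nhat d : R) : set R :=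
  [set b | [/\ 0 < b, zeta <= b / d & b <= Nhat]].

Definition maximizer (R : realType) (alpha kappa zeta Nhat d p b : R) : Prop :=
  feasible zeta Nhat d b /\
  forall b', feasible zeta Nhat d b' ->
    u_CP alpha kappa d p b' <= u_CP alpha kappa d p b.

(* Extended-real valued; -oo for an infeasible problem. *)
Definition optimal_value (R : realType) (alpha kappa zeta Nhat d p : R)
    : \bar R :=
  ereal_sup [set (u_CP alpha kappa d p b)%:E | b in feasible zeta Nhat d].

(* true = join (1), false = exit (0). *)
Definition participation (R : realType) (alpha kappa zeta Nhat d p : R)
    : bool :=
  ~~ `[< [\/ d = 0,
             feasible zeta Nhat d = set0
           | (optimal_value alpha kappa zeta Nhat d p < 0)%E] >].

(* The set of all optimal decisions (b, z): z is the participation variable,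
   and b is a maximizer of the utility when z = true, and None (no number of
   bits is chosen) when z = false.  That a decision is "the" optimal one is
   expressed by this set being a singleton. *)
Definition optimal_decisions (R : realType) (alpha kappa zeta Nhat d p : R)
    : set (option R * bool) :=
  [set bz | bz.2 = participation alpha kappa zeta Nhat d p /\
     match bz.1 with
     | Some b => bz.2 = true /\ maximizer alpha kappa zeta Nhat d p b
     | None => bz.2 = false
     end].

(* Main.v *)
Require Import Defs.
From HB Require Import structures.
From mathcomp Require Import all_boot all_order all_algebra.
From mathcomp Require Import all_classical all_reals all_analysis.
From mathcomp Require Import ring lra.

Set Implicit Arguments.
Unset Strict Implicit.
Unset Printing Implicit Defensive.

Import Order.TTheory GRing.Theory Num.Theory.
Local Open Scope classical_set_scope.
Local Open Scope ring_scope.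

(* The advertising utility is strictly concave in b, so it lies strictly below
   its tangent at any b0.  Hence a feasible b0 is the unique maximizer as soon as
   (alpha * d / b0 - p) * (b - b0) <= 0 for every feasible b: at b0 = Nhat and
   b0 = zeta * d the slope has the right sign, and at b0 = alpha * d / p it
   vanishes.  The optimal value is at least the utility at b0 = zeta * d, which
   is d * (alpha * ln (kappa * zeta) - p * zeta); it is nonnegative exactly below
   the exit price, and above that price zeta * d is the maximizer. *)

(** The strict inequality [1 + y < expR y] for [y != 0], taken at [y = ln x]. *)
Lemma ln_lt_subr1 (R : realType) (x : R) : 0 < x -> x != 1 -> ln x < x - 1.
Proof.
move=> x0 x1; have lnx0 : ln x != 0 by rewrite ln_eq0.
by rewrite ltrBrDl -{2}(lnK x0) expR_gt1Dx.
Qed.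

(** With [r = b / b0], the logarithmic term grows by [alpha * d * ln r] and its tangent by
    [alpha * d * (r - 1)], while the linear cost [p * b] is the same on both sides. Strictness is
    what later makes the maximizer unique. *)
Lemma u_CP_lt_tangent (R : realType) (alpha kappa d p b b0 : R) :
  0 < alpha -> 0 < kappa -> 0 < d -> 0 < b -> 0 < b0 -> b != b0 ->
  u_CP alpha kappa d p b
  < u_CP alpha kappa d p b0 + (alpha * d / b0 - p) * (b - b0).
Proof.
move=> a0 k0 d0 b_gt0 b0_gt0 bb0; rewrite /u_CP /u_ad d0.
have lnE : ln (kappa * b / d) = ln (b / b0) + ln (kappa * b0 / d).
  rewrite -lnM ?posrE ?divr_gt0 ?mulr_gt0 //; congr (ln _).
  by field; rewrite !gt_eqF.
have r1 : b / b0 != 1 by apply: contra_neq bb0 => /divr1_eq.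
have := ln_lt_subr1 (divr_gt0 b_gt0 b0_gt0) r1.
rewrite -(ltr_pM2l (mulr_gt0 a0 d0)) lnE => lt_ln.
have -> : (alpha * d / b0 - p) * (b - b0)
    = alpha * d * (b / b0 - 1) - p * b + p * b0.
  by field; rewrite gt_eqF.
lra.
Qed.

Lemma maximizer_by_slope (R : realType) (alpha kappa zeta Nhat d p b0 : R) :
  0 < alpha -> 0 < kappa -> 0 < d -> feasible zeta Nhat d b0 ->
  (forall b, feasible zeta Nhat d b -> (alpha * d / b0 - p) * (b - b0) <= 0) ->
  maximizer alpha kappa zeta Nhat d p = [set b0].
Proof.
move=> a0 k0 d0 fb0 slope.
have lt_u b : feasible zeta Nhat d b -> b != b0 ->
    u_CP alpha kappa d p b < u_CP alpha kappa d p b0.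
  move=> fb bb0; have [b_gt0 _ _] := fb; have [b0_gt0 _ _] := fb0.
  apply: lt_le_trans (u_CP_lt_tangent p a0 k0 d0 b_gt0 b0_gt0 bb0) _.
  by rewrite gerDl slope.
apply/seteqP; split=> b /=.
  move=> [fb maxb]; apply/eqP/negPn/negP => bb0.
  by have := lt_le_trans (lt_u b fb bb0) (maxb b0 fb0); rewrite ltxx.
move=> ->; split=> // b' fb'.
by have [->|bb0] := eqVneq b' b0; last exact/ltW/lt_u.
Qed.

Lemma optimal_decisions_exit (R : realType) (alpha kappa zeta Nhat d p : R) :
  participation alpha kappa zeta Nhat d p = false ->
  optimal_decisions alpha kappa zeta Nhat d p = [set (None, false)].
Proof.
move=> part; apply/seteqP; split=> [[[b|] z]|_ ->] //=;
  rewrite /optimal_decisions /= part.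
- by move=> [-> []].
- by move=> [->].
Qed.

Lemma optimal_decisions_join (R : realType) (alpha kappa zeta Nhat d p b0 : R) :
  participation alpha kappa zeta Nhat d p ->
  maximizer alpha kappa zeta Nhat d p = [set b0] ->
  optimal_decisions alpha kappa zeta Nhat d p = [set (Some b0, true)].
Proof.
move=> part maxE; apply/seteqP; split=> [[[b|] z]|_ ->] //=;
  rewrite /optimal_decisions /= part ?maxE.
- by move=> [-> [_ ->]].
- by move=> [->].
- by [].
Qed.

(** Any feasible point bounds the supremum from below, so [b] may differ from the number of bits
    finally chosen. *)
Lemma participation_by_nonneg (R : realType) (alpha kappa zeta Nhat d p b : R) :
  d != 0 -> feasible zeta Nhat d b -> 0 <= u_CP alpha kappa d p b ->
  participation alpha kappa zeta Nhat d p.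
Proof.
move=> d0 fb u_ge0; apply/asboolPn => -[/eqP|f0|].
- by rewrite (negPf d0).
- by move: fb; rewrite f0.
- apply/negP; rewrite -leNgt; apply: (@le_trans _ _ (u_CP alpha kappa d p b)%:E).
    by rewrite lee_fin.
  by apply: ereal_sup_ubound; exists b.
Qed.

(** Negative utilities alone could still have supremum 0; a maximizer attains the supremum and so
    keeps it strictly negative. *)
Lemma no_participation_by_neg_max
    (R : realType) (alpha kappa zeta Nhat d p b : R) :
  maximizer alpha kappa zeta Nhat d p b -> u_CP alpha kappa d p b < 0 ->
  participation alpha kappa zeta Nhat d p = false.
Proof.
move=> [_ maxb] u_lt0; apply/negbTE; rewrite negbK; apply/asboolP/Or33.
apply: (@le_lt_trans _ _ (u_CP alpha kappa d p b)%:E); last by rewrite lte_fin.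
by apply: ge_ereal_sup => _ [b' fb' <-]; rewrite lee_fin maxb.
Qed.

Lemma u_CP_min_quality (R : realType) (alpha kappa zeta d p : R) :
  0 < d ->
  u_CP alpha kappa d p (zeta * d)
  = d * (alpha * ln (kappa * zeta) - p * zeta).
Proof.
by move=> d0; rewrite /u_CP /u_ad d0 mulrA mulfK ?gt_eqF//; ring.
Qed.

Theorem theorem1 (R : realType) (alpha kappa zeta Nhat : R)
  (alpha_gt0 : 0 < alpha) (kappa_gt0 : 0 < kappa)
  (zeta_gt0 : 0 < zeta) (Nhat_gt0 : 0 < Nhat)
  (kappa_zeta : expR 1 < kappa * zeta)
  (d p : R) (d_ge0 : 0 <= d) :
  (0 < d <= Nhat / zeta ->
    [/\ p <= alpha * d / Nhat ->
          optimal_decisions alpha kappa zeta Nhat d p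
          = [set (Some Nhat, true)],
        alpha * d / Nhat <= p <= alpha / zeta ->
          optimal_decisions alpha kappa zeta Nhat d p
          = [set (Some (alpha * d / p), true)],
        alpha / zeta <= p <= alpha * ln (kappa * zeta) / zeta ->
          optimal_decisions alpha kappa zeta Nhat d p
          = [set (Some (zeta * d), true)]
      & alpha * ln (kappa * zeta) / zeta < p ->
          optimal_decisions alpha kappa zeta Nhat d p
          = [set (None, false)]])
  /\
  (Nhat / zeta < d \/ d = 0 ->
    optimal_decisions alpha kappa zeta Nhat d p = [set (None, false)]).
Proof.
have ln_gt1 : 1 < ln (kappa * zeta).
  by rewrite -ltr_expR lnK // posrE mulr_gt0.
split; last first.
  move=> Hd; apply: optimal_decisions_exit.
  apply/negbTE; rewrite negbK; apply/asboolP.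
  case: Hd => [dN|->]; last by constructor 1.
  constructor 2; apply/seteqP; split=> b //= -[b0 zb bN].
  have d0 : 0 < d by rewrite (lt_trans _ dN) ?divr_gt0.
  (* The quality bound and the cap would give [zeta * d <= b <= Nhat], against [Nhat < d * zeta]. *)
  move: zb dN; rewrite ler_pdivlMr// ltr_pdivrMr// => zb dN; lra.
move=> /andP[d0 dN].
have zdN : zeta * d <= Nhat by rewrite mulrC -ler_pdivlMr.
have feasE b : feasible zeta Nhat d b <-> zeta * d <= b <= Nhat.
  split=> [[_ zb bN]|/andP[zb bN]]; first by rewrite -ler_pdivlMr// zb.
  by split; rewrite ?ler_pdivlMr// (lt_le_trans _ zb) ?mulr_gt0.
have feas_zd : feasible zeta Nhat d (zeta * d) by apply/feasE; rewrite lexx.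
(* This is [zeta * d <= Nhat] rescaled. Together with [slope_exit] it orders the three price
   thresholds, which places the first two price ranges below the exit price. *)
have slope_N : alpha * d / Nhat <= alpha / zeta.
  rewrite ler_pdivrMr// mulrAC ler_pdivlMr// -mulrA ler_pM2l//; lra.
(* Here [kappa * zeta > e] enters, through [ln (kappa * zeta) > 1]. *)
have slope_exit : alpha / zeta < alpha * ln (kappa * zeta) / zeta.
  by rewrite ltr_pM2r ?invr_gt0// ltr_pMr.
have slope_zd : alpha * d / (zeta * d) = alpha / zeta.
  by field; rewrite !gt_eqF.
have max_zd : alpha / zeta <= p ->
    maximizer alpha kappa zeta Nhat d p = [set zeta * d].
  move=> pz; apply: maximizer_by_slope => // b /feasE/andP[zb _].
  by rewrite slope_zd; apply: mulr_le0_ge0; rewrite ?subr_le0 ?subr_ge0.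
(* Participation is tested at [zeta * d], whatever the maximizer [b0] is, so one argument serves all
   three joining ranges. *)
have join b0 : p <= alpha * ln (kappa * zeta) / zeta ->
    maximizer alpha kappa zeta Nhat d p = [set b0] ->
    optimal_decisions alpha kappa zeta Nhat d p = [set (Some b0, true)].
  move=> p_le; apply: optimal_decisions_join.
  apply: participation_by_nonneg feas_zd _; first by rewrite gt_eqF.
  by rewrite u_CP_min_quality// pmulr_rge0// subr_ge0 -ler_pdivlMr.
split.
- move=> pN; apply: join; first lra.
  apply: maximizer_by_slope => //; first by apply/feasE; rewrite zdN lexx.
  move=> b /feasE/andP[_ bN].
  by apply: mulr_ge0_le0; rewrite ?subr_ge0 ?subr_le0.
- move=> /andP[pN pz]; apply: join; first lra.
  have ad0 : 0 < alpha * d by rewrite mulr_gt0.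
  (* The price is an arbitrary real; its lower bound makes it positive here, so the two price bounds
     turn into [zeta * d <= alpha * d / p <= Nhat]. *)
  have p0 : 0 < p by rewrite (lt_le_trans _ pN) ?divr_gt0.
  apply: maximizer_by_slope => //.
    apply/feasE; rewrite ler_pdivlMr// ler_pdivrMr//.
    move: pN pz; rewrite ler_pdivrMr// ler_pdivlMr// => pN pz.
    by rewrite mulrAC ler_pM2r// (mulrC zeta) pz (mulrC Nhat).
  by move=> b _; rewrite invf_div mulrCA divff ?gt_eqF// mulr1 subrr mul0r.
- by move=> /andP[pz p_le]; apply: join => //; exact: max_zd.
- move=> p_gt; apply: optimal_decisions_exit.
  apply: (@no_participation_by_neg_max _ _ _ _ _ _ _ (zeta * d)).
    by rewrite max_zd//; lra.
  by rewrite u_CP_min_quality// pmulr_rlt0// subr_lt0 -ltr_pdivrMr.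
Qed.
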